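(* Let $D_n^{\ast}$, $\mathrm{Lip}_M(\alpha)$ and $\Omega_n^2$ be as defined in the context. Let $0<\alpha\le1$, $M>0$ and $f\in\mathrm{Lip}_M(\alpha)$. Then for every $n\in\mathbb{N}$ and every $x\in[0,\infty)$, $$\left|D_n^{\ast}(f;x)-f(x)\right|\le M\left(\Omega_n^{2}(x)\right)^{\frac{\alpha}{2}}.$$
   Context: Fix real numbers $\mu\ge 0$ and $\lambda\ge 0$. For $k\in\mathbb{N}_0$ put $\theta_k=0$ if $k$ is even and $\theta_k=1$ if $k$ is odd. The coefficients $\gamma_\mu$ are $$\gamma_\mu(2k)=\frac{2^{2k}k!\,\Gamma(k+\mu+\frac12)}{\Gamma(\mu+\frac12)},\qquad \gamma_\mu(2k+1)=\frac{2^{2k+1}k!\,\Gamma(k+\mu+\frac32)}{\Gamma(\mu+\frac12)},\quad k\in\mathbb{N}_0,$$ and they satisfy $\gamma_\mu(k+1)=(k+1+2\mu\theta_{k+1})\gamma_\mu(k)$. The Dunkl exponential is $e_\mu(x)=\sum_{k=0}^\infty \frac{x^k}{\gamma_\mu(k)}$. Let $(a_r)_{r\ge0}$ be real numbers with $a_0\neq0$ such that $A(t)=\sum_{r=0}^\infty\frac{a_r}{\gamma_\mu(r)}t^r$ is analytic in a disc $|t|<R$ with $R>1$; assume $A(1)\ne0$ and $\frac{a_r}{A(1)}\ge0$ for all $r\ge0$. The Dunkl–Appell polynomials $p_k$ are $$p_k(x)=\sum_{m=0}^k\frac{\gamma_\mu(k)}{\gamma_\mu(m)\gamma_\mu(k-m)}a_{k-m}x^m,$$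 equivalently $A(t)e_\mu(xt)=\sum_{k=0}^\infty\frac{p_k(x)}{\gamma_\mu(k)}t^k$. For $n\in\mathbb{N}=\{1,2,\dots\}$, $x\in[0,\infty)$ and $f\in C[0,\infty)$ (for which the expression is defined), $$D_n^{\ast}(f;x)=\frac{1}{e_\mu(nx)A(1)}\sum_{k=0}^\infty\frac{p_k(nx)}{\gamma_\mu(k)}\frac{n^{k+2\mu\theta_k+\lambda+1}}{\Gamma(k+2\mu\theta_k+\lambda+1)}\int_0^\infty e^{-nt}t^{k+2\mu\theta_k+\lambda}f(t)\,dt.$$ $\Omega_n^2(x):=D_n^{\ast}((t-x)^2;x)$, i.e. $D_n^{\ast}$ applied to the function $t\mapsto(t-x)^2$ and evaluated at $x$ (the superscript $2$ in $\Omega_n^2$ is an index, not a power). For $M>0$ and $0<\alpha\le1$, $\mathrm{Lip}_M(\alpha)$ is the set of real-valued continuous functions $f$ on $[0,\infty)$ with $|f(x)-f(y)|\le M|x-y|^{\alpha}$ for all $x,y\in[0,\infty)$. *)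

(* Defs.v *)
From HB Require Import structures.
From mathcomp Require Import all_boot all_order all_algebra.
From mathcomp Require Import all_classical all_reals all_analysis.
Set Implicit Arguments. Unset Strict Implicit. Unset Printing Implicit Defensive.
Import Order.TTheory GRing.Theory Num.Theory.
Import numFieldNormedType.Exports.
Local Open Scope classical_set_scope.
Local Open Scope ring_scope.

(* Integrals are real-valued Lebesgue integrals, and the sum
   of a series is the limit of its partial sums; both are total operations, with
   an unspecified or default value where the integral or the limit does not
   exist. *)

(* Euler's integral, used only for x > 0. *)
Definition Gamma (R : realType) (x : R) : R :=
  \int[lebesgue_measure]_(t in `]0, +oo[) (t `^ (x - 1) * expR (- t)).

Definition theta (R : realType) (k : nat) : R := (odd k)%:R.

(* If j = 2k or j = 2k + 1, then j./2 = k. *)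
Definition dunkl_gamma (R : realType) (mu : R) (j : nat) : R :=
  if odd j then
    2 ^+ j * (j./2)`!%:R * Gamma ((j./2)%:R + mu + 3 / 2) / Gamma (mu + 1 / 2)
  else
    2 ^+ j * (j./2)`!%:R * Gamma ((j./2)%:R + mu + 1 / 2) / Gamma (mu + 1 / 2).

Definition dunkl_exp (R : realType) (mu x : R) : R :=
  limn (series (fun k => x ^+ k / dunkl_gamma mu k)).

Definition appell_term (R : realType) (mu : R) (a : nat -> R) (t : R) : nat -> R :=
  fun r => a r / dunkl_gamma mu r * t ^+ r.

Definition appell_A (R : realType) (mu : R) (a : nat -> R) (t : R) : R :=
  limn (series (appell_term mu a t)).

(* The power series with coefficients a r / dunkl_gamma mu r converges in the
   disc of radius rho. Convergence at all real t with |t| < rho means that the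
   radius of convergence is at least rho, i.e. that the sum is analytic in that
   disc. *)
Definition appell_analytic (R : realType) (mu : R) (a : nat -> R) (rho : R) : Prop :=
  forall t : R, `|t| < rho -> cvgn (series (appell_term mu a t)).

Definition dunkl_appell (R : realType) (mu : R) (a : nat -> R) (k : nat) (x : R) : R :=
  \sum_(m < k.+1)
    dunkl_gamma mu k / (dunkl_gamma mu m * dunkl_gamma mu (k - m)%N)
      * a (k - m)%N * x ^+ m.

Definition dstar_expo (R : realType) (mu lam : R) (k : nat) : R :=
  k%:R + 2 * mu * theta R k + lam.

(* Only the values of f on [0, +oo[ matter. *)
Definition Dstar (R : realType) (mu lam : R) (a : nat -> R) (n : nat)
    (f : R -> R) (x : R) : R :=
  1 / (dunkl_exp mu (n%:R * x) * appell_A mu a 1) *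
  limn (series (fun k =>
    dunkl_appell mu a k (n%:R * x) / dunkl_gamma mu k *
    (n%:R `^ (dstar_expo mu lam k + 1) / Gamma (dstar_expo mu lam k + 1)) *
    \int[lebesgue_measure]_(t in `[0, +oo[)
      (expR (- (n%:R * t)) * t `^ dstar_expo mu lam k * f t))).

Definition Omega2 (R : realType) (mu lam : R) (a : nat -> R) (n : nat) (x : R) : R :=
  Dstar mu lam a n (fun t => (t - x) ^+ 2) x.

Definition Lip (R : realType) (M alpha : R) (f : R -> R) : Prop :=
  {within `[0, +oo[, continuous f} /\
  forall x y : R, 0 <= x -> 0 <= y -> `|f x - f y| <= M * `|x - y| `^ alpha.

(* Main.v *)
Require Import Defs.
From HB Require Import structures.
From mathcomp Require Import all_boot all_order all_algebra.
From mathcomp Require Import all_classical all_reals all_analysis.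
From mathcomp Require Import measurable_realfun ring lra.
Set Implicit Arguments. Unset Strict Implicit. Unset Printing Implicit Defensive.
Import Order.TTheory GRing.Theory Num.Theory.
Import numFieldNormedType.Exports.
Local Open Scope classical_set_scope.
Local Open Scope ring_scope.

(** For each [k], the expression multiplying the [k]-th weight in [Dstar] is the
    mean of [f] under a probability law, the Gamma law of shape
    [dstar_expo mu lam k + 1] and rate [n]; and the weights
    [dunkl_appell mu a k (n x) / (dunkl_gamma mu k * e_mu(n x) * A(1))] are
    nonnegative with sum 1, as one sees by putting t = 1 in the generating
    identity A(t) e_mu(y t) = sum_k p_k(y) t^k / gamma_mu(k). So [Dstar] is an
    averaging operator, and a bound |f t - v| <= p + q (t - x)^2 on the half-line
    passes to the averages: |D f - v| <= p + q Omega2 ([Dstar_bound]).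

    The theorem follows by a choice of p and q. The function u |-> u^(alpha/2) is
    concave, so it lies below its tangent line at S = Omega2
    ([powR_tangent_le]). Taking u = (t - x)^2 bounds M |t - x|^alpha by such a
    quadratic in t, and the tangent line evaluated at S itself is
    S^(alpha/2). This is Jensen's inequality for the average, and it takes the
    place of two applications of Hoelder's inequality, one to the integrals and
    one to the series.

    As [Dstar] is built from total operators, the existence of every
    integral and sum has to be established. Three facts carry this.

    - Euler's integral is finite and satisfies its functional equation
      ([euler_integralS], [euler_integral_fin_num]). This gives the
      moments of the Gamma laws ([gamma_mean_quadratic]) and the growth
      gamma_mu(k) >= k!, hence the convergence of e_mu.
    - The generating identity is a Cauchy product of nonnegative series
      ([cvg_cauchy_product], [cvg_appell_weight]).
    - The second moments of the Gamma laws grow like k^2, hence no faster than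
      tau^k for any tau > 1. With 1 < tau < rho the generating identity at
      t = tau makes their weighted sum converge
      ([is_cvg_weighted_gamma_moment2]). This is where analyticity of A beyond
      the unit disc enters.

    Finally S > 0, which the tangent line needs, because each of these
    Gamma laws has second moment at least 1/n^2 about any point. *)

(** * Euler's integral *)

Local Notation leb := lebesgue_measure.

Definition euler_integrand (R : realType) (x t : R) : R :=
  t `^ (x - 1) * expR (- t).

(** The extended-real integral behind [Gamma]: the functional equation holds
    for it before finiteness is known, and finiteness is then deduced from that
    equation. *)
Definition euler_integral (R : realType) (x : R) : \bar R :=
  (\int[leb]_(t in `]0%R, +oo[) (euler_integrand x t)%:E)%E.

Lemma euler_integrand_ge0 (R : realType) (x t : R) : 0 <= euler_integrand x t.
Proof. by rewrite mulr_ge0 ?powR_ge0 ?expR_ge0. Qed.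

Lemma measurable_expRN (R : realType) (c : R) (D : set R) :
  measurable_fun D (fun t : R => expR (- (c * t))).
Proof.
apply: measurable_funTS; apply: measurableT_comp => //.
by apply: measurableT_comp => //; exact: measurable_funM.
Qed.

Lemma measurable_euler_integrand (R : realType) (x : R) (D : set R) :
  measurable_fun D (euler_integrand x).
Proof.
apply: measurable_funM; first exact: measurable_funTS.
by under eq_fun do rewrite -[X in expR (- X)]mul1r; exact: measurable_expRN.
Qed.

Lemma euler_integral_ge0 (R : realType) (x : R) : (0 <= euler_integral x)%E.
Proof. by apply: integral_ge0 => t _; rewrite lee_fin euler_integrand_ge0. Qed.

Lemma GammaE (R : realType) (x : R) : Gamma x = fine (euler_integral x).
Proof. by []. Qed.

(** The interval stays away from 0 because t^x has an unbounded derivative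
    there when x < 1. *)
Lemma integration_by_parts_euler (R : realType) (x a b : R) : 0 < a -> a < b ->
  (\int[leb]_(t in `[a, b]) (euler_integrand (x + 1) t)%:E =
   (a `^ x * expR (- a) - b `^ x * expR (- b))%:E +
   x%:E * \int[leb]_(t in `[a, b]) (euler_integrand x t)%:E)%E.
Proof.
move=> a0 ab.
have pos t : t \in `[a, b] -> 0 < t.
  by rewrite in_itv/= => /andP[at_ _]; exact: lt_le_trans at_.
have poso t : t \in `]a, b[ -> 0 < t.
  by rewrite in_itv/= => /andP[at_ _]; exact: lt_trans at_.
have dpow (y t : R) : 0 < t -> derivable (fun u : R => u `^ y) t 1.
  by move=> t0; apply: derivable_powR; rewrite in_itv/= t0.
have cpow (y t : R) : 0 < t -> {for t, continuous (fun u : R => u `^ y)}.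
  move=> t0; apply: differentiable_continuous.
  by apply/derivable1_diffP; exact: dpow.
have dexp (t : R) : is_derive t 1 (fun u : R => - expR (- u)) (expR (- t)).
  apply: is_derive_eq; rewrite /GRing.scale/=; ring.
have cexp (t : R) : {for t, continuous (fun u : R => - expR (- u))}.
  apply: differentiable_continuous.
  by apply/derivable1_diffP; exact: (@ex_derive _ _ _ _ _ _ _ (dexp t)).
have := @integration_by_parts R (fun u : R => u `^ x) (fun t => - expR (- t))
  (fun t => x * t `^ (x - 1)) (fun t => expR (- t)) a b ab.
have -> : (fun t : R => (t `^ x * expR (- t))%:E) =
          (fun t => (euler_integrand (x + 1) t)%:E).
  by apply/funext => t; rewrite /euler_integrand addrK.
move=> ->.
- have -> : (fun t : R => (x * t `^ (x - 1) * - expR (- t))%:E) =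
            (fun t : R => (- x)%:E * (euler_integrand x t)%:E)%E.
    by apply/funext => t; rewrite /euler_integrand -EFinM; congr EFin; ring.
  rewrite integralZl//=; last first.
    apply: continuous_compact_integrable; first exact: segment_compact.
    apply: derivable_within_continuous => t /pos t0.
    apply: derivableM; first exact: dpow.
    by apply: ex_derive.
  rewrite -mulNe EFinN oppeK; congr (_%:E + _)%E; ring.
- apply: derivable_within_continuous => t /pos t0.
  by apply: derivableM => //; exact: dpow.
- split.
  + by move=> t /poso; exact: dpow.
  + by apply: cvg_at_right_filter; apply: cpow.
  + by apply: cvg_at_left_filter; apply: cpow; exact: lt_trans ab.
- by move=> t /poso t0; rewrite powR_derive1// in_itv/= t0.
- apply: derivable_within_continuous => t _; exact: ex_derive.
- split.
  + by move=> t _; exact: (@ex_derive _ _ _ _ _ _ _ (dexp t)).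
  + by apply: cvg_at_right_filter; apply: cexp.
  + by apply: cvg_at_left_filter; apply: cexp.
- by move=> t _; rewrite derive1E; exact: (@derive_val _ _ _ _ _ _ _ (dexp t)).
Qed.

(** The term of order N+1 in the exponential series beats t^(x+1) as soon as
    N >= x, which leaves a factor 1/t. *)
Lemma powR_expRN_le (R : realType) (x : R) : 0 <= x ->
  exists2 C : R, 0 <= C & forall t, 1 <= t -> t `^ x * expR (- t) <= C / t.
Proof.
move=> x0.
have [N xN] : exists N : nat, x <= N%:R.
  by exists (Num.truncn x).+1; apply/ltW/truncnS_gt.
exists (N.+1)`!%:R => // t t1.
have t0 : 0 < t by exact: lt_le_trans t1.
rewrite ler_pdivlMr// expRN mulrAC ler_pdivrMr ?expR_gt0//.
have := expR_ge1Dxn N (ltW t0); rewrite -subr_ge0 => h.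
have hN : t ^+ N.+1 / (N.+1)`!%:R <= expR t by lra.
rewrite ler_pdivrMr ?ltr0n ?fact_gt0// in hN.
rewrite mulrC [leRHS]mulrC (le_trans _ hN)// exprS ler_pM2l// -powR_mulrn ?(ltW t0)//.
exact: ler_powR.
Qed.

(** Integration by parts on the intervals [1/(m+2), m+2] exhausting the
    half-line: the integrals converge by monotonicity, and both boundary terms
    vanish in the limit. *)
Lemma euler_integralS (R : realType) (x : R) : 0 < x ->
  euler_integral (x + 1) = (x%:E * euler_integral x)%E.
Proof.
move=> x0.
pose b (m : nat) : R := m.+2%:R.
pose I m := `[(b m)^-1, b m]%classic.
pose B (t : R) := t `^ x * expR (- t).
have b0 m : 0 < b m by rewrite ltr0n.
have b1 m : 1 < b m by rewrite ltr1n.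
have ltb m : (b m)^-1 < b m.
  by rewrite (lt_trans _ (b1 m))// invf_lt1.
have ndI : nondecreasing_seq I.
  move=> m n mn; rewrite subsetEset => t; rewrite /I/= !in_itv/= => /andP[h1 h2].
  have bmn : b m <= b n by rewrite ler_nat.
  by rewrite (le_trans _ h1)/= ?lef_pV2 ?posrE// (le_trans h2).
have UI : \bigcup_m I m = `]0%R, +oo[%classic.
  apply/seteqP; split => [t [m _]|t].
    rewrite /I/= !in_itv/= => /andP[h _]; rewrite andbT.
    by apply: lt_le_trans h; rewrite invr_gt0.
  rewrite /= in_itv/= andbT => t0.
  pose M := maxn (Num.truncn t) (Num.truncn t^-1).
  exists M => //; rewrite /I/= in_itv/=.
  have h y : (Num.truncn y <= M)%N -> y <= b M.
    move=> yM; apply/ltW/(lt_le_trans (truncnS_gt _)).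
    by rewrite ler_nat ltnS (leq_trans yM).
  rewrite h ?leq_maxl// andbT -[leRHS]invrK lef_pV2 ?posrE ?invr_gt0//.
  by rewrite h ?leq_maxr.
have cvgI y : (\int[leb]_(t in I m) (euler_integrand y t)%:E)%E @[m --> \oo] -->
    euler_integral y.
  rewrite /euler_integral -UI; apply: ge0_nondecreasing_set_cvg_integral => //.
  - by move=> m; exact: measurable_itv.
  - by move=> m; apply/measurable_EFinP; exact: measurable_euler_integrand.
  - by move=> m t _; rewrite lee_fin euler_integrand_ge0.
have boundary0 : (B (b m)^-1 - B (b m))%:E @[m --> \oo] --> (0 : \bar R)%E.
  apply: cvg_EFin; first exact: nearW.
  have cvgb : (b m)^-1 @[m --> \oo] --> (0 : R).
    by have := @cvg_harmonic R; rewrite -cvg_shiftS.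
  have -> : (0 : R) = 0 - 0 by rewrite subr0.
  apply: cvgB; last first.
    have [C C0 BC] := powR_expRN_le (ltW x0).
    apply: (@squeeze_cvgr _ _ _ _ (fun=> 0) (fun m => C * (b m)^-1)).
    - apply: nearW => m; rewrite mulr_ge0 ?powR_ge0 ?expR_ge0//=.
      by apply: BC; exact/ltW.
    - exact: cvg_cst.
    - by rewrite -(mulr0 C); apply: cvgMl_tmp.
  apply: (@squeeze_cvgr _ _ _ _ (fun=> 0) (fun m => (b m)^-1 `^ x)).
  - apply: nearW => m; rewrite mulr_ge0 ?powR_ge0 ?expR_ge0//=.
    rewrite ler_piMr ?powR_ge0// -[leRHS]expR0 ler_expR.
    by rewrite oppr_le0 invr_ge0 ltW.
  - exact: cvg_cst.
  - have := @powR_cvg0 R x x0 => /cvg_at_rightP; apply; split => // m.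
    by rewrite invr_gt0.
have := cvgI (x + 1).
have -> : (fun m => \int[leb]_(t in I m) (euler_integrand (x + 1) t)%:E)%E =
    (fun m => (B (b m)^-1 - B (b m))%:E +
              x%:E * \int[leb]_(t in I m) (euler_integrand x t)%:E)%E.
  by apply/funext => m; rewrite (integration_by_parts_euler x _ (ltb m)) ?invr_gt0.
move=> /(@cvg_unique _ (@ereal_hausdorff R)); apply.
rewrite -[(x%:E * _)%E]add0e; apply: cvgeD.
- by rewrite fin_num_adde_defr.
- exact: boundary0.
- by apply: cvgeZl => //; exact: cvgI.
Qed.

Lemma euler_integral1 (R : realType) : euler_integral (1 : R) = 1%E.
Proof.
transitivity (\int[leb]_(t in `[0%R, +oo[) (euler_integrand (1 : R) t)%:E)%E.
  apply: integral_itv_obnd_cbnd.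
  by apply/measurable_EFinP; exact: measurable_euler_integrand.
rewrite -[RHS](@integral_exponential_pdf R 1)// integral_mkcond.
apply: eq_integral => t _; rewrite /exponential_pdf !patchE; case: ifP => // _.
by rewrite /euler_integrand subrr powRr0 !mul1r mulN1r.
Qed.

(** At positive integers the functional equation gives the value. For
    1 <= y <= N + 1 one has t^(y-1) <= 1 + t^N, so Euler's integral at y is at
    most the sum of its values at 1 and N + 1. The functional equation carries finiteness
    down from x + 1 to x, which covers the singular range x < 1. *)
Lemma euler_integral_fin_num (R : realType) (x : R) : 0 < x ->
  euler_integral x \is a fin_num.
Proof.
have nat_fin (N : nat) : euler_integral (N.+1%:R : R) \is a fin_num.
  elim: N => [|N IH]; first by rewrite euler_integral1.
  by rewrite -natr1 euler_integralS ?ltr0n// fin_numM.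
have ge1_fin (y : R) : 1 <= y -> euler_integral y \is a fin_num.
  move=> y1; set N := Num.truncn y.
  have y0 : 0 < y by exact: lt_le_trans y1.
  have yN : y <= N.+1%:R by apply/ltW/truncnS_gt.
  rewrite ge0_fin_numE ?euler_integral_ge0//.
  apply: (@le_lt_trans _ _ (euler_integral 1 + euler_integral N.+1%:R)%E); last first.
    apply: lte_add_pinfty; first by rewrite euler_integral1 ltry.
    by have := nat_fin N; rewrite ge0_fin_numE// euler_integral_ge0.
  rewrite /euler_integral -ge0_integralD//=; last 4 first.
  - by move=> t _; rewrite lee_fin euler_integrand_ge0.
  - by apply/measurable_EFinP; exact: measurable_euler_integrand.
  - by move=> t _; rewrite lee_fin euler_integrand_ge0.
  - by apply/measurable_EFinP; exact: measurable_euler_integrand.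
  apply: ge0_le_integral => //.
  - by move=> t _; rewrite lee_fin euler_integrand_ge0.
  - by apply/measurable_EFinP; exact: measurable_euler_integrand.
  - apply/measurable_EFinP; apply: measurable_funD;
    exact: measurable_euler_integrand.
  move=> t /=; rewrite in_itv/= andbT => t0.
  rewrite -EFinD lee_fin /euler_integrand -mulrDl ler_wpM2r ?expR_ge0//.
  rewrite subrr powRr0; have [t1|t1] := leP t 1.
    have : t `^ (y - 1) <= 1.
      by rewrite -[leRHS](powRr0 t); apply: ger_powR; rewrite ?t0// subr_ge0.
    by move=> h; rewrite (le_trans h)// lerDl powR_ge0.
  by rewrite ler_wpDl// ler_powR ?lerD2r// ltW.
move=> x0; have := ge1_fin (x + 1); rewrite lerDr (ltW x0) => /(_ isT).
rewrite euler_integralS// => h.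
have -> : euler_integral x = (x^-1%:E * (x%:E * euler_integral x))%E.
  by rewrite muleA -EFinM mulVf ?gt_eqF// mul1e.
by rewrite fin_numM.
Qed.

Lemma Gamma_EFin (R : realType) (x : R) : 0 < x ->
  (Gamma x)%:E = euler_integral x.
Proof. by move=> x0; rewrite GammaE fineK// euler_integral_fin_num. Qed.

Lemma GammaS (R : realType) (x : R) : 0 < x -> Gamma (x + 1) = x * Gamma x.
Proof.
move=> x0; apply: EFin_inj; rewrite EFinM !Gamma_EFin ?addr_gt0//.
exact: euler_integralS.
Qed.

(** On [1, 2] the integrand is at least e^(-2)/2. *)
Lemma Gamma_gt0 (R : realType) (x : R) : 0 < x -> 0 < Gamma x.
Proof.
move=> x0; rewrite -lte_fin Gamma_EFin//.
pose m : R := 2^-1 * expR (- 2).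
have m0 : 0 < m by rewrite mulr_gt0 ?expR_gt0.
apply: (@lt_le_trans _ _ (\int[leb]_(t in `[1%R, 2%R]) m%:E)%E).
  rewrite integral_cst//= lebesgue_measure_itv/= lte_fin ltr1n.
  by rewrite -EFinB -EFinM lte_fin mulr_gt0// subr_gt0 ltr1n.
apply: (@le_trans _ _ (\int[leb]_(t in `[1%R, 2%R]) (euler_integrand x t)%:E)%E).
  apply: ge0_le_integral => //.
  - by move=> t _; rewrite lee_fin ltW.
  - by apply/measurable_EFinP; exact: measurable_euler_integrand.
  move=> t /=; rewrite in_itv/= => /andP[t1 t2]; rewrite lee_fin.
  have t0 : 0 < t by exact: lt_le_trans t1.
  apply: ler_pM; rewrite ?expR_ge0 ?invr_ge0//; last by rewrite ler_expR lerN2.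
  apply: (@le_trans _ _ (t `^ (-1))).
    by rewrite powR_inv1 ?(ltW t0)// lef_pV2 ?posrE.
  by apply: ler_powR => //; rewrite lerDr ltW.
apply: ge0_subset_integral => //.
- by apply/measurable_EFinP; exact: measurable_euler_integrand.
- by move=> t _; rewrite lee_fin euler_integrand_ge0.
move=> t /=; rewrite !in_itv/= andbT => /andP[t1 _].
exact: lt_le_trans t1.
Qed.

(** * The kernel of a Gamma law *)

Definition gamma_kernel (R : realType) (c s t : R) : R :=
  expR (- (c * t)) * t `^ s.

Lemma gamma_kernel_ge0 (R : realType) (c s t : R) : 0 <= gamma_kernel c s t.
Proof. by rewrite mulr_ge0 ?powR_ge0 ?expR_ge0. Qed.

Lemma measurable_gamma_kernel (R : realType) (c s : R) (D : set R) :
  measurable_fun D (gamma_kernel c s).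
Proof.
apply: measurable_funM; first exact: measurable_expRN.
exact: measurable_funTS.
Qed.

Lemma gamma_kernelX (R : realType) (c s t : R) (j : nat) : 0 <= s -> 0 <= t ->
  gamma_kernel c s t * t ^+ j = gamma_kernel c (s + j%:R) t.
Proof.
move=> s0 t0; rewrite /gamma_kernel -mulrA -powR_mulrn//; congr (_ * _).
case: j => [|j]; first by rewrite powRr0 addr0 mulr1.
by rewrite powRD// gt_eqF ?ltr_wpDl ?ltr0n.
Qed.

Lemma within_continuous_euler_integrand (R : realType) (s : R) : 0 <= s ->
  {within `[0, +oo[, continuous (euler_integrand (s + 1))}.
Proof.
move=> s0; rewrite /euler_integrand addrK.
have cexp (t : R) : {for t, continuous (fun u : R => expR (- u))}.
  by apply: differentiable_continuous; apply/derivable1_diffP; exact: ex_derive.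
apply/continuous_within_itvcyP; split.
  move=> t; rewrite in_itv/= andbT => t0.
  have cpow : {for t, continuous (fun u : R => u `^ s)}.
    apply: differentiable_continuous; apply/derivable1_diffP.
    by apply: derivable_powR; rewrite in_itv/= t0.
  by apply: cvgM; [exact: cpow|exact: cexp].
apply: cvgM; last by apply: cvg_at_right_filter; exact: cexp.
move: s0; rewrite le_eqVlt => /predU1P[<-|s0].
  under eq_fun do rewrite powRr0; rewrite powRr0; exact: cvg_cst.
by rewrite powR0 ?gt_eqF//; exact: powR_cvg0.
Qed.

(** The substitution u = c t. The exponent s is nonnegative, so the integrand
    is continuous up to 0. *)
Lemma integral_gamma_kernel (R : realType) (c s : R) : 0 < c -> 0 <= s ->
  (\int[leb]_(t in `[0%R, +oo[) (gamma_kernel c s t)%:E =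
   (Gamma (s + 1) / c `^ (s + 1))%:E)%E.
Proof.
move=> c0 s0.
have dF (t : R) : is_derive t 1 (fun u : R => c * u) c.
  by apply: is_derive_eq; rewrite /GRing.scale/= mulr1.
have F'E : (fun u : R => c * u)^`()%classic = cst c.
  by apply/funext => t; rewrite derive1E; exact: (@derive_val _ _ _ _ _ _ _ (dF t)).
have cF (t : R) : {for t, continuous (fun u : R => c * u)}.
  by apply: cvgMl_tmp; exact: cvg_id.
have := @increasing_ge0_integration_by_substitutiony R (fun u => c * u)
  (euler_integrand (s + 1)) 0.
rewrite F'E mulr0 => subst.
have {subst}: (\int[leb]_(t in `[0%R, +oo[) (euler_integrand (s + 1) t)%:E =
  \int[leb]_(t in `[0%R, +oo[) ((c `^ (s + 1))%:E * (gamma_kernel c s t)%:E))%E.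
  rewrite subst.
  - apply: eq_integral => t; rewrite inE/= in_itv/= andbT => t0.
    rewrite -EFinM; congr EFin.
    rewrite fctE/= /euler_integrand /gamma_kernel addrK powRM ?(ltW c0)// powRD; last first.
      by rewrite gt_eqF// ltr_wpDl.
    by rewrite powRr1 ?(ltW c0)//=; ring.
  - by move=> u v _ _ uv; rewrite ltr_pM2l.
  - by move=> u _; exact: cst_continuous.
  - exact: is_cvg_cst.
  - exact: is_cvg_cst.
  - split; first by move=> u _; exact: (@ex_derive _ _ _ _ _ _ _ (dF u)).
    by apply: cvg_at_right_filter; exact: cF.
  - by apply: gt0_cvgMry => //; exact: cvg_id.
  - exact: within_continuous_euler_integrand.
  - by move=> u _; exact: euler_integrand_ge0.
rewrite -integral_itv_obnd_cbnd; last first.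
  by apply/measurable_EFinP; exact: measurable_euler_integrand.
rewrite -/(euler_integral _) -Gamma_EFin ?ltr_wpDl//.
rewrite ge0_integralZl//=; last 3 first.
- by apply/measurable_EFinP; exact: measurable_gamma_kernel.
- by move=> t _; rewrite lee_fin gamma_kernel_ge0.
- by rewrite lee_fin powR_ge0.
rewrite EFinM => ->; rewrite muleC muleA -EFinM mulVf ?mul1e//.
by rewrite gt_eqF// powR_gt0.
Qed.

Lemma integrable_gamma_kernel (R : realType) (c s : R) : 0 < c -> 0 <= s ->
  leb.-integrable `[0, +oo[ (EFin \o gamma_kernel c s).
Proof.
move=> c0 s0; apply/integrableP; split.
  by apply/measurable_EFinP; exact: measurable_gamma_kernel.
under eq_integral => t _ do rewrite /= ger0_norm ?gamma_kernel_ge0//.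
by rewrite integral_gamma_kernel// ltry.
Qed.

Lemma Rintegral_gamma_kernel (R : realType) (c s : R) : 0 < c -> 0 <= s ->
  \int[leb]_(t in `[0, +oo[) gamma_kernel c s t = Gamma (s + 1) / c `^ (s + 1).
Proof. by move=> c0 s0; rewrite /Rintegral integral_gamma_kernel. Qed.

(** * Means under Gamma laws *)

(** The mean of [f] under the Gamma law of shape [s + 1] and rate [c]. The
    grouping of factors is that of [Dstar]. *)
Definition gamma_mean (R : realType) (c s : R) (f : R -> R) : R :=
  c `^ (s + 1) / Gamma (s + 1) *
  \int[leb]_(t in `[0, +oo[) (gamma_kernel c s t * f t).

(** The second moment about [x] of the Gamma law of shape [s + 1] and rate
    [c], as squared bias plus variance; see [gamma_mean_sqr]. *)
Definition gamma_moment2 (R : realType) (c s x : R) : R :=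
  ((s + 1) / c - x) ^+ 2 + (s + 1) / c ^+ 2.

(** A quadratic factor turns the kernel into a combination of kernels of
    exponents s, s + 1 and s + 2, so all its integrals are values of [Gamma]. *)
Lemma gamma_kernel_quadraticE (R : realType) (c s p q x t : R) :
  0 <= s -> 0 <= t ->
  gamma_kernel c s t * (p + q * (t - x) ^+ 2) =
  (p + q * x ^+ 2) * gamma_kernel c s t +
  (- (2 * q * x) * gamma_kernel c (s + 1) t + q * gamma_kernel c (s + 2) t).
Proof.
move=> s0 t0.
by rewrite -(gamma_kernelX c 1 s0 t0) -(gamma_kernelX c 2 s0 t0); ring.
Qed.

Lemma integrable_gamma_quadratic (R : realType) (c s p q x : R) :
  0 < c -> 0 <= s ->
  leb.-integrable `[0, +oo[
    (EFin \o (fun t => gamma_kernel c s t * (p + q * (t - x) ^+ 2))).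
Proof.
move=> c0 s0.
have iZ (r y : R) : 0 <= y ->
    leb.-integrable `[0, +oo[ (fun t => r%:E * (gamma_kernel c y t)%:E)%E.
  by move=> y0; apply: integrableZl => //; exact: integrable_gamma_kernel.
apply: (@eq_integrable _ _ _ leb _ _ (fun t =>
  (p + q * x ^+ 2)%:E * (gamma_kernel c s t)%:E +
  ((- (2 * q * x))%:E * (gamma_kernel c (s + 1) t)%:E +
   q%:E * (gamma_kernel c (s + 2) t)%:E))%E) => //.
  move=> t; rewrite inE/= in_itv/= andbT => t0.
  by rewrite -!EFinM -!EFinD gamma_kernel_quadraticE.
by do ?apply: integrableD => //; apply: iZ; rewrite ?addr_ge0.
Qed.

Lemma gamma_mean_quadratic (R : realType) (c s p q x : R) : 0 < c -> 0 <= s ->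
  gamma_mean c s (fun t => p + q * (t - x) ^+ 2) = p + q * gamma_moment2 c s x.
Proof.
move=> c0 s0; rewrite /gamma_mean.
have i (y : R) : 0 <= y -> leb.-integrable `[0, +oo[ (EFin \o gamma_kernel c y).
  by move=> y0; exact: integrable_gamma_kernel.
have iZ (r y : R) : 0 <= y ->
    leb.-integrable `[0, +oo[ (EFin \o (fun t => r * gamma_kernel c y t)).
  move=> y0; apply: (@eq_integrable _ _ _ leb _ _
    (fun t => r%:E * (gamma_kernel c y t)%:E)%E) => //.
  by apply: integrableZl => //; exact: i.
have s1 : 0 <= s + 1 by rewrite addr_ge0.
have s2 : 0 <= s + 2 by rewrite addr_ge0.
under eq_Rintegral => t.
  rewrite inE/= in_itv/= andbT => t0.
  rewrite gamma_kernel_quadraticE//.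
  over.
rewrite RintegralD//; [|exact: iZ|]; last first.
  apply: (@eq_integrable _ _ _ leb _ _
    (fun t => (- (2 * q * x) * gamma_kernel c (s + 1) t)%:E +
              (q * gamma_kernel c (s + 2) t)%:E)%E) => //.
  by apply: integrableD => //; exact: iZ.
rewrite RintegralD//; [|exact: iZ|exact: iZ].
rewrite !RintegralZl ?Rintegral_gamma_kernel//; [|exact: i|exact: i|exact: i].
have cE (y : R) : 0 <= y -> c `^ (y + 1) = c `^ y * c.
  by move=> y0; rewrite powRD ?powRr1 ?ltW// gt_eqF// ltr_wpDl.
have GE (y : R) : 0 <= y -> Gamma (y + 1 + 1) = (y + 1) * Gamma (y + 1).
  by move=> y0; rewrite GammaS// ltr_wpDl.
have -> : s + 2 = s + 1 + 1 by ring.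
rewrite !GE// !cE//; last by rewrite addr_ge0.
have := Gamma_gt0 (ltr_wpDl s0 ltr01).
have := powR_gt0 s c0.
rewrite /gamma_moment2; set G := Gamma _; set P := c `^ s => P0 G0.
by field; rewrite !gt_eqF.
Qed.

Lemma gamma_mean_sqr (R : realType) (c s x : R) : 0 < c -> 0 <= s ->
  gamma_mean c s (fun t => (t - x) ^+ 2) = gamma_moment2 c s x.
Proof.
move=> c0 s0; rewrite -[RHS]mul1r -[RHS]add0r -gamma_mean_quadratic//.
by congr (gamma_mean c s _); apply/funext => t; rewrite add0r mul1r.
Qed.

(** A probability law preserves constants and order. The hypothesis also
    yields the integrability of [f], by domination. *)
Lemma gamma_mean_bound (R : realType) (c s v p q x : R) (f : R -> R) :
  0 < c -> 0 <= s -> measurable_fun (`[0, +oo[%classic : set R) f ->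
  (forall t, 0 <= t -> `|f t - v| <= p + q * (t - x) ^+ 2) ->
  `|gamma_mean c s f - v| <= p + q * gamma_moment2 c s x.
Proof.
move=> c0 s0 mf fv.
have i0 : 0 < c `^ (s + 1) / Gamma (s + 1).
  by rewrite divr_gt0 ?powR_gt0// Gamma_gt0// ltr_wpDl.
have iq := integrable_gamma_quadratic p q x c0 s0.
have ifv : leb.-integrable `[0, +oo[
    (EFin \o (fun t => gamma_kernel c s t * (f t - v))).
  apply: le_integrable iq => //.
    apply/measurable_EFinP; apply: measurable_funM.
      exact: measurable_gamma_kernel.
    exact: measurable_funB.
  move=> t /=; rewrite in_itv/= andbT => t0; rewrite lee_fin.
  rewrite !normrM ler_wpM2l// (le_trans (fv t t0))//.
  exact: ler_norm.
have iv : leb.-integrable `[0, +oo[ (EFin \o (fun t => gamma_kernel c s t * v)).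
  apply: (@eq_integrable _ _ _ leb _ _
    (fun t => (gamma_kernel c s t)%:E * v%:E)%E) => //.
  by apply: integrableZr => //; exact: integrable_gamma_kernel.
have -> : gamma_mean c s f - v =
    c `^ (s + 1) / Gamma (s + 1) *
    \int[leb]_(t in `[0, +oo[) (gamma_kernel c s t * (f t - v)).
  (* A law of total mass 1 fixes constants: the quadratic case with q = 0. *)
  have {1}<- : gamma_mean c s (fun=> v) = v.
    have := gamma_mean_quadratic v 0 0 c0 s0; rewrite mul0r addr0 => {2}<-.
    by congr (gamma_mean c s _); apply/funext => t; rewrite mul0r addr0.
  apply/eqP; rewrite subr_eq /gamma_mean -mulrDr -RintegralD//; apply/eqP.
  by congr (_ * _); apply: eq_Rintegral => t _; rewrite -mulrDr subrK.
rewrite normrM gtr0_norm// -gamma_mean_quadratic// ler_wpM2l ?(ltW i0)//.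
apply: (le_trans (le_normr_Rintegral _ ifv)) => //.
apply: le_Rintegral => //; first exact: integrable_norm ifv.
move=> t /=; rewrite in_itv/= andbT => t0.
by rewrite normrM ger0_norm ?gamma_kernel_ge0// ler_wpM2l ?gamma_kernel_ge0// fv.
Qed.

(** * Nonnegative series and weighted averages *)

Definition cauchy_product (R : realType) (u v : nat -> R) (k : nat) : R :=
  \sum_(m < k.+1) u m * v (k - m)%N.

(** Summing over the triangle i + j < n by rows: row m contributes [u m] times
    a partial sum of [v]. *)
Lemma series_cauchy_product (R : realType) (u v : nat -> R) (n : nat) :
  series (cauchy_product u v) n = \sum_(m < n) u m * series v (n - m)%N.
Proof.
elim: n => [|n IH]; first by rewrite /series/= big_nil big_ord0.
have -> : series (cauchy_product u v) n.+1 =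
    series (cauchy_product u v) n + cauchy_product u v n.
  by rewrite /series/= big_nat_recr.
rewrite IH.
have -> : \sum_(m < n) u m * series v (n - m)%N =
          \sum_(m < n.+1) u m * series v (n - m)%N.
  by rewrite big_ord_recr/= subnn /series/= big_nil mulr0 addr0.
rewrite /cauchy_product -big_split/=; apply: eq_bigr => m _.
rewrite subSn; last by rewrite -ltnS ltn_ord.
by rewrite -mulrDr /series/= big_nat_recr.
Qed.

(** The triangle i + j < n lies in the square i, j < n, and the triangle
    i + j < 2 n contains that square. With nonnegative terms the partial
    sums of the Cauchy product are thus squeezed between products of partial
    sums. *)
Lemma cvg_cauchy_product (R : realType) (u v : nat -> R) :
  (forall k, 0 <= u k) -> (forall k, 0 <= v k) ->
  cvgn (series u) -> cvgn (series v) ->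
  series (cauchy_product u v) @ \oo --> limn (series u) * limn (series v).
Proof.
move=> u0 v0 cu cv.
pose C := series (cauchy_product u v).
have ndu : nondecreasing_seq (series u) by apply: nondecreasing_series => *.
have ndv : nondecreasing_seq (series v) by apply: nondecreasing_series => *.
have su0 k : 0 <= series u k by apply: sumr_ge0.
have sv0 k : 0 <= series v k by apply: sumr_ge0.
have c0 k : 0 <= cauchy_product u v k.
  by apply: sumr_ge0 => m _; exact: mulr_ge0.
have ndC : nondecreasing_seq C by apply: nondecreasing_series => *.
have seriesE k : series u k = \sum_(m < k) u m by rewrite /series/= big_mkord.
have le1 k : C k <= limn (series u) * limn (series v).
  apply: (@le_trans _ _ (series u k * series v k)).
    rewrite /C series_cauchy_product seriesE mulr_suml.
    apply: ler_sum => m _; rewrite ler_wpM2l//.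
    by apply: ndv; rewrite leq_subr.
  by apply: ler_pM => //; exact: nondecreasing_cvgn_le.
have le2 k : series u k * series v k <= C k.*2.
  rewrite /C series_cauchy_product seriesE mulr_suml.
  apply: (@le_trans _ _ (\sum_(m < k) u m * series v (k.*2 - m)%N)).
    apply: ler_sum => m _; rewrite ler_wpM2l//.
    apply: ndv; rewrite -addnn -addnBA ?leq_addr//; exact/ltnW.
  rewrite -(big_mkord xpredT (fun m => u m * series v (k.*2 - m)%N)).
  rewrite -(big_mkord xpredT (fun m => u m * series v (k.*2 - m)%N)).
  rewrite [leRHS](@big_cat_nat _ _ _ k)//=; last by rewrite -addnn leq_addr.
  by rewrite lerDl; apply: sumr_ge0 => m _; exact: mulr_ge0.
have cC : cvgn C.
  apply: nondecreasing_is_cvgn => //.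
  by exists (limn (series u) * limn (series v)) => _ [k _ <-].
suff <- : limn C = limn (series u) * limn (series v) by [].
apply/eqP; rewrite eq_le; apply/andP; split.
  by apply: limr_le => //; exact: nearW.
rewrite -limM//; apply: limr_le; first exact: is_cvgM.
apply: nearW => k; rewrite /= (le_trans (le2 k))//.
exact: nondecreasing_cvgn_le.
Qed.

(** The discrete counterpart of [gamma_mean_bound]: convergence comes from
    the dominating series, the inequality from the weights having sum 1. *)
Lemma weighted_average_bound (R : realType) (w V m : nat -> R) (v p q : R) :
  (forall k, 0 <= w k) -> series w @ \oo --> (1 : R) ->
  cvgn (series (fun k => w k * V k)) ->
  (forall k, `|m k - v| <= p + q * V k) ->
  cvgn (series (fun k => w k * m k)) /\
  `|limn (series (fun k => w k * m k)) - v| <=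
    p + q * limn (series (fun k => w k * V k)).
Proof.
move=> w0 w1 cV mV.
have cw : cvgn (series w) by apply/cvg_ex; exists 1.
have lw : limn (series w) = 1 by apply/cvg_lim.
have cvw (r : R) : cvgn (series (r *: w)) by exact: is_cvg_seriesZ.
have cqV : cvgn (series (q *: (fun k => w k * V k))) by exact: is_cvg_seriesZ.
pose D k := w k * (m k - v).
pose B k := w k * (p + q * V k).
have BE : B = p *: w + q *: (fun k => w k * V k).
  by apply/funext => k; rewrite /B !fctE/= /GRing.scale/=; ring.
have cB : cvgn (series B) by rewrite BE; exact: is_cvg_seriesD.
have DB k : `|D k| <= B k by rewrite normrM ger0_norm// ler_wpM2l.
have cND : cvgn [normed series D].
  apply: series_le_cvg cB => // k; first exact: normr_ge0.
  exact: le_trans (normr_ge0 _) (DB k).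
have cD : cvgn (series D) by exact: normed_cvg.
have mE : (fun k => w k * m k) = D + v *: w.
  by apply/funext => k; rewrite /D !fctE/= /GRing.scale/=; ring.
split; first by rewrite mE; exact: is_cvg_seriesD.
rewrite mE lim_seriesD// lim_seriesZ// lw.
rewrite /GRing.scale/= mulr1 addrK.
apply: (le_trans (lim_series_norm cND)).
apply: (le_trans (lim_series_le cND cB DB)).
by rewrite BE lim_seriesD// !lim_seriesZ// lw /GRing.scale/= mulr1.
Qed.

(** Concavity of u |-> u^b in the form of its tangent line at S. It is
    Young's inequality for (u/S)^b and 1 with exponents 1/b and 1/(1-b). *)
Lemma powR_tangent_le (R : realType) (b S u : R) : 0 < b -> b < 1 -> 0 < S ->
  0 <= u -> u `^ b <= (1 - b) * S `^ b + b * S `^ b / S * u.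
Proof.
move=> b0 b1 S0 u0.
have b1' : 0 < 1 - b by rewrite subr_gt0.
have uS0 : 0 <= u / S by rewrite divr_ge0 ?(ltW S0).
have := @conjugate_powR R ((u / S) `^ b) 1 b^-1 (1 - b)^-1 (powR_ge0 _ _) ler01.
rewrite !invr_gt0 !invrK => /(_ b0 b1').
rewrite addrCA subrr addr0 => /(_ erefl).
rewrite mulr1 -powRrM mulfV ?gt_eqF// powRr1// powR1 mul1r => h.
have -> : u `^ b = S `^ b * (u / S) `^ b.
  by rewrite -powRM ?(ltW S0)// mulrCA mulfV ?gt_eqF// mulr1.
apply: le_trans (ler_wpM2l (powR_ge0 _ _) h) _.
rewrite le_eqVlt; apply/orP; left; apply/eqP; field.
by rewrite gt_eqF.
Qed.

(** For h = ln tau and y = k + B, the exponential series gives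
    (h y)^2 / 2 <= e^(h y) = tau^k e^(h B). *)
Lemma sqr_le_geometric (R : realType) (B tau : R) : 0 <= B -> 1 < tau ->
  exists2 C : R, 0 <= C & forall k : nat, (k%:R + B) ^+ 2 <= C * tau ^+ k.
Proof.
move=> B0 t1; have h0 : 0 < ln tau by rewrite ln_gt0.
have t0 : 0 < tau by exact: lt_trans t1.
exists (2 / ln tau ^+ 2 * expR (ln tau * B)).
  by rewrite mulr_ge0 ?expR_ge0// divr_ge0 ?exprn_ge0 ?ltW.
move=> k; set y := k%:R + B.
have y0 : 0 <= y by rewrite addr_ge0.
have := @expR_ge1Dxn R (ln tau * y) 1 (mulr_ge0 (ltW h0) y0).
rewrite exprMn => h.
have {h} : ln tau ^+ 2 * y ^+ 2 / 2 <= expR (ln tau * y).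
  by apply: le_trans h; rewrite lerDr.
rewrite /y mulrDr expRD expRM_natr lnK ?posrE// -/y => h.
have -> : y ^+ 2 = 2 / ln tau ^+ 2 * (ln tau ^+ 2 * y ^+ 2 / 2).
  by field; rewrite gt_eqF.
rewrite -[leRHS]mulrA ler_wpM2l ?divr_ge0 ?exprn_ge0 ?(ltW h0)//.
by rewrite [leRHS]mulrC.
Qed.

(** * The Dunkl exponential and the Appell weights *)

Lemma dunkl_gamma_gt0 (R : realType) (mu : R) (k : nat) : 0 <= mu ->
  0 < dunkl_gamma mu k.
Proof.
move=> mu0; rewrite /dunkl_gamma.
by case: ifP => _; rewrite divr_gt0 ?mulr_gt0 ?exprn_gt0 ?ltr0n ?fact_gt0//;
  apply: Gamma_gt0; rewrite ltr_wpDl ?addr_ge0.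
Qed.

Lemma dunkl_gamma0 (R : realType) (mu : R) : 0 <= mu -> dunkl_gamma mu 0 = 1.
Proof.
move=> mu0; rewrite /dunkl_gamma/= fact0 expr0 !mul1r add0r divff// gt_eqF//.
by apply: Gamma_gt0; rewrite ltr_wpDl.
Qed.

(** Besides the power of 2, exactly one factor of the closed formula changes:
    the factorial when k is odd, the value of [Gamma] when k is even. *)
Lemma dunkl_gammaS (R : realType) (mu : R) (k : nat) : 0 <= mu ->
  dunkl_gamma mu k.+1 = (k.+1%:R + 2 * mu * theta R k.+1) * dunkl_gamma mu k.
Proof.
move=> mu0; rewrite /dunkl_gamma /theta/=.
have G0 : Gamma (mu + 1 / 2) != 0.
  by rewrite gt_eqF//; apply: Gamma_gt0; rewrite ltr_wpDl.
case: (boolP (odd k)) => ok /=.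
  rewrite uphalf_half ok add1n.
  have -> : k.+1%:R = 2 * (k./2).+1%:R :> R.
    by rewrite -[in LHS](odd_double_half k) ok -natrM mulnS mul2n.
  have -> : (k./2).+1%:R + mu + 1 / 2 = k./2%:R + mu + 3 / 2 :> R.
    by rewrite -natr1; field.
  rewrite factS natrM exprS.
  move: (Gamma (mu + 1 / 2)) (Gamma _) G0 => G G' G0; by field.
have -> : k.+1%:R = 2 * k./2%:R + 1 :> R.
  by rewrite -natr1 -[in LHS](odd_double_half k) (negbTE ok) -muln2 add0n natrM mulrC.
rewrite uphalf_half (negbTE ok) add0n.
have -> : k./2%:R + mu + 3 / 2 = (k./2%:R + mu + 1 / 2) + 1 :> R by field.
rewrite GammaS ?ltr_wpDl ?addr_ge0// exprS.
move: (Gamma (mu + 1 / 2)) (Gamma _) G0 => G G' G0; by field.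
Qed.

(** By the recurrence each step multiplies by at least k + 1; this makes the
    exponential series a majorant of the Dunkl exponential. *)
Lemma fact_le_dunkl_gamma (R : realType) (mu : R) (k : nat) : 0 <= mu ->
  k`!%:R <= dunkl_gamma mu k.
Proof.
move=> mu0; elim: k => [|k IH]; first by rewrite dunkl_gamma0.
rewrite factS natrM dunkl_gammaS//; apply: ler_pM => //.
by rewrite lerDl !mulr_ge0// ler0n.
Qed.

Definition dunkl_exp_term (R : realType) (mu x : R) (k : nat) : R :=
  x ^+ k / dunkl_gamma mu k.

Lemma dunkl_exp_term_ge0 (R : realType) (mu x : R) (k : nat) :
  0 <= mu -> 0 <= x -> 0 <= dunkl_exp_term mu x k.
Proof.
by move=> mu0 x0; rewrite divr_ge0 ?exprn_ge0// ltW// dunkl_gamma_gt0.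
Qed.

Lemma is_cvg_dunkl_exp (R : realType) (mu x : R) : 0 <= mu -> 0 <= x ->
  cvgn (series (dunkl_exp_term mu x)).
Proof.
move=> mu0 x0; apply: series_le_cvg (is_cvg_series_exp_coeff x) => k.
- exact: dunkl_exp_term_ge0.
- exact: exp_coeff_ge0.
- rewrite ler_wpM2l ?exprn_ge0// lef_pV2 ?posrE ?ltr0n ?fact_gt0 ?dunkl_gamma_gt0//.
  exact: fact_le_dunkl_gamma.
Qed.

Lemma dunkl_exp_ge1 (R : realType) (mu x : R) : 0 <= mu -> 0 <= x ->
  1 <= dunkl_exp mu x.
Proof.
move=> mu0 x0; have cE := is_cvg_dunkl_exp mu0 x0.
have -> : 1 = series (dunkl_exp_term mu x) 1.
  by rewrite /series/= big_nat1 /dunkl_exp_term expr0 dunkl_gamma0// divr1.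
apply: nondecreasing_cvgn_le => //.
by apply: nondecreasing_series => k _ _; exact: dunkl_exp_term_ge0.
Qed.

(** The weight of the [k]-th Gamma law in [Dstar] at the point x, with
    y = n x. *)
Definition appell_weight (R : realType) (mu : R) (a : nat -> R) (y : R) (k : nat) : R :=
  dunkl_appell mu a k y / dunkl_gamma mu k / (dunkl_exp mu y * appell_A mu a 1).

(** Up to the factor 1/e_mu(y), the weights times tau^k are the Cauchy
    product of the series of e_mu(y tau) and of A(tau)/A(1). Dividing by A(1)
    inside the second factor makes its terms nonnegative, since the
    coefficients a_r all have the sign of A(1). *)
Lemma appell_weightE (R : realType) (mu : R) (a : nat -> R) (y tau : R) (k : nat) :
  0 <= mu ->
  appell_weight mu a y k * tau ^+ k =
  (dunkl_exp mu y)^-1 * cauchy_product (dunkl_exp_term mu (y * tau))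
    (fun r => (appell_A mu a 1)^-1 * appell_term mu a tau r) k.
Proof.
move=> mu0; rewrite /appell_weight /cauchy_product /dunkl_appell invfM.
rewrite !mulr_suml mulr_sumr; apply: eq_bigr => m _.
have mk : (m <= k)%N by rewrite -ltnS ltn_ord.
have -> : tau ^+ k = tau ^+ (k - m) * tau ^+ m by rewrite -exprD subnK.
rewrite /dunkl_exp_term /appell_term exprMn.
have g0 j : dunkl_gamma mu j != 0 by rewrite gt_eqF ?dunkl_gamma_gt0.
move: (g0 k) (g0 m) (g0 (k - m)%N).
move: (dunkl_gamma mu k) (dunkl_gamma mu m) (dunkl_gamma mu (k - m)).
move: (dunkl_exp mu y)^-1 (appell_A mu a 1)^-1 => E A gk gm gd gk0 gm0 gd0.
by field; rewrite gk0 gm0 gd0.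
Qed.

Lemma appell_weight_ge0 (R : realType) (mu : R) (a : nat -> R) (y : R) (k : nat) :
  0 <= mu -> 0 <= y -> (forall r, 0 <= a r / appell_A mu a 1) ->
  0 <= appell_weight mu a y k.
Proof.
move=> mu0 y0 a0; rewrite -[leRHS]mulr1 -(expr1n _ k) appell_weightE//.
have E0 : 0 <= dunkl_exp mu y by exact: le_trans (dunkl_exp_ge1 mu0 y0).
rewrite mulr_ge0 ?invr_ge0//; apply: sumr_ge0 => m _.
rewrite mulr_ge0 ?dunkl_exp_term_ge0 ?mulr1//.
rewrite /appell_term expr1n mulr1 mulrA mulr_ge0//.
  by rewrite mulrC.
by rewrite invr_ge0 ltW// dunkl_gamma_gt0.
Qed.

(** The generating identity at t = tau, normalised by its value at t = 1. *)
Lemma cvg_appell_weight (R : realType) (mu : R) (a : nat -> R) (rho y tau : R) :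
  0 <= mu -> 0 <= y -> appell_analytic mu a rho ->
  (forall r, 0 <= a r / appell_A mu a 1) -> 0 <= tau -> tau < rho ->
  series (fun k => appell_weight mu a y k * tau ^+ k) @ \oo -->
  dunkl_exp mu (y * tau) / dunkl_exp mu y * (appell_A mu a tau / appell_A mu a 1).
Proof.
move=> mu0 y0 hA a0 t0 trho.
have cA : cvgn (series (appell_term mu a tau)) by apply: hA; rewrite ger0_norm.
have yt0 : 0 <= y * tau by exact: mulr_ge0.
pose B := (appell_A mu a 1)^-1 *: appell_term mu a tau.
have B0 k : 0 <= B k.
  rewrite /B /appell_term fctE/= /GRing.scale/= !mulrA mulr_ge0 ?exprn_ge0//.
  by rewrite mulr_ge0 ?invr_ge0 ?(ltW (dunkl_gamma_gt0 _ _))// mulrC.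
have cB : cvgn (series B) by exact: is_cvg_seriesZ.
have cE := is_cvg_dunkl_exp mu0 yt0.
have -> : (fun k => appell_weight mu a y k * tau ^+ k) =
    (dunkl_exp mu y)^-1 *: cauchy_product (dunkl_exp_term mu (y * tau)) B.
  by apply/funext => k; rewrite appell_weightE.
have := cvg_cauchy_product (fun k => dunkl_exp_term_ge0 k mu0 yt0) B0 cE cB.
rewrite lim_seriesZ// seriesZ.
rewrite (_ : _ / _ * _ = (dunkl_exp mu y)^-1 *: (dunkl_exp mu (y * tau) *
  ((appell_A mu a 1)^-1 *: appell_A mu a tau))); last first.
  by rewrite /GRing.scale/=; ring.
by move=> h; apply: cvgZl_tmp.
Qed.

(** * The averaging operator *)

(** The variance alone is (s + 1)/c^2. *)
Lemma gamma_moment2_ge (R : realType) (c s x : R) : 0 < c -> 0 <= s ->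
  (c ^+ 2)^-1 <= gamma_moment2 c s x.
Proof.
move=> c0 s0; rewrite /gamma_moment2 ler_wpDl ?sqr_ge0//.
by rewrite ler_peMl ?invr_ge0 ?exprn_ge0 ?(ltW c0)// lerDr.
Qed.

(** Only quadratic growth in s matters; the constant is a crude choice. *)
Lemma gamma_moment2_le (R : realType) (c s x : R) : 1 <= c -> 0 <= s ->
  gamma_moment2 c s x <= (3 + 2 * x ^+ 2) * (s + 1) ^+ 2.
Proof.
move=> c1 s0; rewrite /gamma_moment2; set z := s + 1.
have c0 : 0 < c by exact: lt_le_trans c1.
have z1 : 1 <= z by rewrite lerDr.
have w0 : 0 <= z / c by rewrite divr_ge0 ?(ltW c0)//; lra.
have wz : z / c <= z by rewrite ler_pdivrMr// ler_peMr//; lra.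
have -> : z / c ^+ 2 = z / c / c by rewrite expr2 invfM mulrA.
have ww : z / c / c <= z / c by rewrite ler_pdivrMr// ler_peMr.
move: (z / c) (z / c / c) w0 wz ww => w u w0 wz ww.
have w2 : w ^+ 2 <= z ^+ 2 by rewrite ler_sqr ?nnegrE//; lra.
have zz : z <= z ^+ 2 by rewrite expr2 ler_peMl//; lra.
have xz : x ^+ 2 <= x ^+ 2 * z ^+ 2.
  by rewrite ler_peMr ?sqr_ge0//; lra.
have := sqr_ge0 (w + x); rewrite sqrrD sqrrB => h.
lra.
Qed.

Lemma dstar_expo_ge0 (R : realType) (mu lam : R) (k : nat) :
  0 <= mu -> 0 <= lam -> 0 <= dstar_expo mu lam k.
Proof. by move=> mu0 lam0; rewrite /dstar_expo /theta !addr_ge0 ?mulr_ge0. Qed.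

Lemma dstar_expo_le (R : realType) (mu lam : R) (k : nat) : 0 <= mu ->
  dstar_expo mu lam k <= k%:R + (2 * mu + lam).
Proof.
move=> mu0; rewrite /dstar_expo /theta addrA lerD2r lerD2l.
by rewrite ler_piMr ?mulr_ge0// lern1 leq_b1.
Qed.

(** Quadratic growth of the second moments is absorbed by tau^k with tau
    strictly between 1 and rho, where the generating identity still converges. *)
Lemma is_cvg_weighted_gamma_moment2 (R : realType) (mu lam : R) (a : nat -> R)
    (rho c x y : R) :
  0 <= mu -> 0 <= lam -> 1 < rho -> appell_analytic mu a rho ->
  (forall r, 0 <= a r / appell_A mu a 1) -> 1 <= c -> 0 <= y ->
  cvgn (series (fun k => appell_weight mu a y k * gamma_moment2 c (dstar_expo mu lam k) x)).
Proof.
move=> mu0 lam0 rho1 hA a0 c1 y0.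
have c0 : 0 < c by exact: lt_le_trans c1.
pose tau := (1 + rho) / 2.
have tau1 : 1 < tau by rewrite /tau; lra.
have taurho : tau < rho by rewrite /tau; lra.
have tau0 : 0 <= tau by lra.
have B0 : 0 <= 2 * mu + lam + 1 by lra.
have [C C0 hC] := sqr_le_geometric B0 tau1.
have w0 k : 0 <= appell_weight mu a y k by exact: appell_weight_ge0.
pose K := (3 + 2 * x ^+ 2) * C.
have K0 : 0 <= K by rewrite mulr_ge0// addr_ge0// mulr_ge0// sqr_ge0.
have cw : cvgn (series (K *: (fun k => appell_weight mu a y k * tau ^+ k))).
  apply: is_cvg_seriesZ; apply: cvgP.
  exact: (cvg_appell_weight mu0 y0 hA a0 tau0 taurho).
apply: series_le_cvg cw => k.
- rewrite mulr_ge0// (le_trans _ (gamma_moment2_ge _ c0 (dstar_expo_ge0 k mu0 lam0)))//.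
  by rewrite invr_ge0 exprn_ge0// ltW.
- by rewrite fctE/= /GRing.scale/= mulr_ge0// mulr_ge0// exprn_ge0.
rewrite fctE/= /GRing.scale/= mulrCA ler_wpM2l//.
apply: (le_trans (gamma_moment2_le x c1 (dstar_expo_ge0 k mu0 lam0))).
rewrite /K -mulrA ler_wpM2l//.
  by rewrite addr_ge0// mulr_ge0// sqr_ge0.
apply: le_trans (hC k).
have := dstar_expo_ge0 k mu0 lam0; have := dstar_expo_le lam k mu0 => h1 h2.
by rewrite ler_sqr ?nnegrE//; have := ler0n R k; lra.
Qed.

(** The constant in front of the series in [Dstar] goes under the sum, which
    requires the resulting series to converge. *)
Lemma DstarE (R : realType) (mu lam : R) (a : nat -> R) (n : nat) (f : R -> R)
    (x : R) :
  let u k := appell_weight mu a (n%:R * x) k *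
             gamma_mean n%:R (dstar_expo mu lam k) f in
  dunkl_exp mu (n%:R * x) != 0 -> appell_A mu a 1 != 0 ->
  cvgn (series u) -> Dstar mu lam a n f x = limn (series u).
Proof.
move=> u E0 A0 cu; rewrite /Dstar.
set EA := dunkl_exp _ _ * appell_A _ _ _.
have EA0 : EA != 0 by rewrite mulf_neq0.
rewrite (_ : (fun k => _) = EA *: u); last first.
  apply/funext => k; rewrite fctE/= /GRing.scale/= /u /appell_weight /gamma_mean.
  rewrite -/EA -[LHS]mulrA [RHS]mulrA; congr (_ * _).
  by rewrite [RHS]mulrC divfK.
by rewrite lim_seriesZ// /GRing.scale/= mul1r mulKf.
Qed.

Lemma Omega2_limn (R : realType) (mu lam : R) (a : nat -> R) (rho : R) (n : nat)
    (x : R) :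
  0 <= mu -> 0 <= lam -> 1 < rho -> appell_analytic mu a rho ->
  appell_A mu a 1 != 0 -> (forall r, 0 <= a r / appell_A mu a 1) ->
  (0 < n)%N -> 0 <= x ->
  Omega2 mu lam a n x = limn (series (fun k => appell_weight mu a (n%:R * x) k *
                                gamma_moment2 n%:R (dstar_expo mu lam k) x)).
Proof.
move=> mu0 lam0 rho1 hA A0 a0 n0 x0.
have c1 : 1 <= n%:R :> R by rewrite ler1n.
have c0 : 0 < n%:R :> R by rewrite ltr0n.
have y0 : 0 <= n%:R * x by rewrite mulr_ge0.
have E0 : dunkl_exp mu (n%:R * x) != 0.
  by rewrite gt_eqF// (lt_le_trans ltr01)// dunkl_exp_ge1.
have e : (fun k => appell_weight mu a (n%:R * x) k *
    gamma_mean n%:R (dstar_expo mu lam k) (fun t => (t - x) ^+ 2)) =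
  (fun k => appell_weight mu a (n%:R * x) k *
    gamma_moment2 n%:R (dstar_expo mu lam k) x).
  by apply/funext => k; rewrite gamma_mean_sqr// dstar_expo_ge0.
have cV := @is_cvg_weighted_gamma_moment2 R mu lam a rho n%:R x _ mu0 lam0 rho1 hA a0 c1 y0.
by rewrite /Omega2 DstarE// e.
Qed.

Lemma cvg_appell_weight1 (R : realType) (mu : R) (a : nat -> R) (rho y : R) :
  0 <= mu -> 1 < rho -> appell_analytic mu a rho ->
  appell_A mu a 1 != 0 -> (forall r, 0 <= a r / appell_A mu a 1) -> 0 <= y ->
  series (appell_weight mu a y) @ \oo --> (1 : R).
Proof.
move=> mu0 rho1 hA A0 a0 y0.
have E0 : dunkl_exp mu y != 0.
  by rewrite gt_eqF// (lt_le_trans ltr01)// dunkl_exp_ge1.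
have := cvg_appell_weight mu0 y0 hA a0 ler01 rho1.
rewrite mulr1 !divff// mulr1.
by under eq_fun do rewrite expr1n mulr1.
Qed.

(** A weighted average of second moments that are all at least 1/n^2. *)
Lemma Omega2_gt0 (R : realType) (mu lam : R) (a : nat -> R) (rho : R) (n : nat)
    (x : R) :
  0 <= mu -> 0 <= lam -> 1 < rho -> appell_analytic mu a rho ->
  appell_A mu a 1 != 0 -> (forall r, 0 <= a r / appell_A mu a 1) ->
  (0 < n)%N -> 0 <= x -> 0 < Omega2 mu lam a n x.
Proof.
move=> mu0 lam0 rho1 hA A0 a0 n0 x0.
have c1 : 1 <= n%:R :> R by rewrite ler1n.
have c0 : 0 < n%:R :> R by rewrite ltr0n.
have y0 : 0 <= n%:R * x by rewrite mulr_ge0.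
rewrite (Omega2_limn mu0 lam0 rho1)//.
have w1 := cvg_appell_weight1 mu0 rho1 hA A0 a0 y0.
have cw : cvgn (series (appell_weight mu a (n%:R * x))) by exact: cvgP w1.
have V0 : 0 < (n%:R ^+ 2)^-1 :> R by rewrite invr_gt0 exprn_gt0.
apply: (lt_le_trans V0).
have -> : (n%:R ^+ 2)^-1 =
    limn (series ((n%:R ^+ 2)^-1 *: appell_weight mu a (n%:R * x))) :> R.
  by rewrite lim_seriesZ// (cvg_lim _ w1)// /GRing.scale/= mulr1.
apply: lim_series_le.
- exact: is_cvg_seriesZ.
- exact: (is_cvg_weighted_gamma_moment2 mu0 lam0 rho1 hA a0).
move=> k; rewrite fctE/= /GRing.scale/= mulrC ler_wpM2l ?appell_weight_ge0//.
by apply: gamma_moment2_ge => //; exact: dstar_expo_ge0.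
Qed.

(** [gamma_mean_bound] for each Gamma law, then [weighted_average_bound] for
    the mixture of these laws. *)
Lemma Dstar_bound (R : realType) (mu lam : R) (a : nat -> R) (rho : R) (n : nat)
    (x v p q : R) (f : R -> R) :
  0 <= mu -> 0 <= lam -> 1 < rho -> appell_analytic mu a rho ->
  appell_A mu a 1 != 0 -> (forall r, 0 <= a r / appell_A mu a 1) ->
  (0 < n)%N -> 0 <= x -> measurable_fun (`[0, +oo[%classic : set R) f ->
  (forall t, 0 <= t -> `|f t - v| <= p + q * (t - x) ^+ 2) ->
  `|Dstar mu lam a n f x - v| <= p + q * Omega2 mu lam a n x.
Proof.
move=> mu0 lam0 rho1 hA A0 a0 n0 x0 mf fv.
have c1 : 1 <= n%:R :> R by rewrite ler1n.
have c0 : 0 < n%:R :> R by rewrite ltr0n.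
have y0 : 0 <= n%:R * x by rewrite mulr_ge0.
have E0 : dunkl_exp mu (n%:R * x) != 0.
  by rewrite gt_eqF// (lt_le_trans ltr01)// dunkl_exp_ge1.
have [] := @weighted_average_bound R (appell_weight mu a (n%:R * x))
  (fun k => gamma_moment2 n%:R (dstar_expo mu lam k) x)
  (fun k => gamma_mean n%:R (dstar_expo mu lam k) f) v p q.
- by move=> k; exact: appell_weight_ge0.
- exact: (cvg_appell_weight1 mu0 rho1 hA A0 a0 y0).
- exact: (is_cvg_weighted_gamma_moment2 mu0 lam0 rho1 hA a0).
- by move=> k; apply: gamma_mean_bound => //; exact: dstar_expo_ge0.
by move=> cu; rewrite -DstarE// (Omega2_limn mu0 lam0 rho1).
Qed.

Theorem theorem3 (R : realType) (mu lam : R) (hmu : 0 <= mu) (hlam : 0 <= lam)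
  (a : nat -> R) (ha0 : a 0%N != 0)
  (rho : R) (hrho : 1 < rho) (hA : appell_analytic mu a rho)
  (hA1 : appell_A mu a 1 != 0) (ha : forall r : nat, 0 <= a r / appell_A mu a 1)
  (alpha M : R) (halpha0 : 0 < alpha) (halpha1 : alpha <= 1) (hM : 0 < M)
  (f : R -> R) (hf : Lip M alpha f)
  (n : nat) (hn : (0 < n)%N) (x : R) (hx : 0 <= x) :
  `|Dstar mu lam a n f x - f x| <= M * (Omega2 mu lam a n x) `^ (alpha / 2).
Proof.
have [cf Lf] := hf.
have mf : measurable_fun (`[0, +oo[%classic : set R) f.
  exact: subspace_continuous_measurable_fun.
set S := Omega2 _ _ _ _ _.
have S0 : 0 < S by exact: (Omega2_gt0 hmu hlam hrho hA).
set b := alpha / 2.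
have b0 : 0 < b by rewrite divr_gt0.
have b1 : b < 1 by rewrite /b; lra.
(* The tangent line at S takes the value S `^ b at S. *)
have -> : M * S `^ b =
    M * ((1 - b) * S `^ b) + M * (b * S `^ b / S) * S.
  by field; rewrite gt_eqF.
apply: (Dstar_bound hmu hlam hrho hA) => // t t0.
apply: (le_trans (Lf t x t0 hx)).
rewrite -mulrA -mulrDr ler_wpM2l ?(ltW hM)//.
have -> : `|t - x| `^ alpha = ((t - x) ^+ 2) `^ b.
  rewrite -real_normK ?num_real// -powR_mulrn// -powRrM; congr (_ `^ _).
  by rewrite /b mulrC divfK.
by apply: powR_tangent_le => //; exact: sqr_ge0.
Qed.
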